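(* For every graph $G$, the upper clique transversal number of $G$ is at most the induced matching number of its vertex-clique incidence graph $B_G$.
   Context: All graphs are finite, simple, undirected, and have at least one vertex. A clique is a set of pairwise adjacent vertices; it is maximal if it is not properly contained in another clique. A clique transversal in $G$ is a set of vertices intersecting every maximal clique of $G$; it is minimal if it does not contain any other clique transversal. The upper clique transversal number of $G$ is the maximum size of a minimal clique transversal in $G$. The vertex-clique incidence graph $B_G$ of $G$ is the bipartite graph with parts $X=V(G)$ and $Y=\mathcal{C}_G$, the set of maximal cliques of $G$, in which $x\in X$ and $C\in \mathcal{C}_G$ are adjacent if and only if $x\in C$. An induced matching in a graph is a set $M$ of pairwise disjoint edges such that the set of endpoints of edges in $M$ induces no edges other than those in $M$. The induced matching number of a graph is the maximum size of an induced matching in it. *)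

(* Defs.v *)
From mathcomp Require Import all_boot.

Set Implicit Arguments.
Unset Strict Implicit.
Unset Printing Implicit Defensive.

Record graph := Graph {
  vertex :> finType;
  adj : rel vertex;
  adj_sym : symmetric adj;
  adj_irrefl : irreflexive adj;
  vertex_gt0 : 0 < #|vertex|
}.

Section GraphNotions.
Variable G : graph.

Definition clique (K : {set G}) : bool :=
  [forall x in K, forall y in K, (x != y) ==> adj x y].

Definition maximal_clique (K : {set G}) : bool := maxset clique K.

Definition clique_transversal (S : {set G}) : bool :=
  [forall K : {set G}, maximal_clique K ==> (S :&: K != set0)].

Definition minimal_clique_transversal (S : {set G}) : bool :=
  minset clique_transversal S.

(* [set: G] is a clique transversal, so this is not a maximum over an empty
   family. *)
Definition upper_clique_transversal_number : nat :=
  \max_(S : {set G} | minimal_clique_transversal S) #|S|.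

Definition edges : {set {set G}} :=
  [set e : {set G} | [exists x, exists y, adj x y && (e == [set x; y])]].

(* The last condition says that every edge of the subgraph induced by the
   endpoints of M belongs to M. *)
Definition induced_matching (M : {set {set G}}) : bool :=
  [&& M \subset edges, trivIset M
    & [forall e in edges, (e \subset cover M) ==> (e \in M)]].

Definition induced_matching_number : nat :=
  \max_(M : {set {set G}} | induced_matching M) #|M|.

End GraphNotions.

Section Incidence.
Variable G : graph.

Definition incidence_vertex : finType :=
  (G + {K : {set G} | maximal_clique K})%type.

Definition incidence_adj (u v : incidence_vertex) : bool :=
  match u, v with
  | inl x, inr K => x \in val K
  | inr K, inl x => x \in val K
  | _, _ => false
  end.

Lemma incidence_adj_sym : symmetric incidence_adj.
Proof. by case=> [x|K] [y|L]. Qed.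

Lemma incidence_adj_irrefl : irreflexive incidence_adj.
Proof. by case. Qed.

Lemma incidence_vertex_gt0 : 0 < #|incidence_vertex|.
Proof. by rewrite card_sum ltn_addr // vertex_gt0. Qed.

Definition vertex_clique_incidence_graph : graph :=
  Graph incidence_adj_sym incidence_adj_irrefl incidence_vertex_gt0.

End Incidence.

(* Main.v *)
(** In a minimal clique transversal S every vertex x has a private maximal
    clique K_x, one that meets S exactly in x. The pairs {x, K_x} are pairwise
    disjoint edges of B_G, and a vertex y of S lies in K_x only if y = x, so
    these |S| edges form an induced matching. *)
Require Import Defs.
From mathcomp Require Import all_boot.

(** By minimality [S :\ x] misses some maximal clique [K]. Since [S] itself meets [K], it can do so
    only in [x]. *)
Lemma private_maximal_clique (G : graph) (S : {set G}) (x : G) :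
  minimal_clique_transversal S -> x \in S ->
  exists K : {K : {set G} | maximal_clique K}, S :&: val K = [set x].
Proof.
move=> /minsetP[/forallP trS minS] xS.
have : ~~ clique_transversal (S :\ x).
  apply/negP => /minS/(_ (subD1set _ _)) /setP/(_ x).
  by rewrite !inE eqxx xS.
move=> /forallPn[K]; rewrite negb_imply negbK => /andP[maxK /eqP SxK0].
exists (exist _ K maxK) => /=; apply/eqP.
rewrite eqEsubset sub1set.
have SKx : S :&: K \subset [set x].
  apply/subsetP => y /setIP[yS yK]; rewrite inE; apply: contraT => y'x.
  by move/setP/(_ y): SxK0; rewrite !inE y'x yS yK.
rewrite SKx /=; have /implyP/(_ maxK)/set0Pn[y ySK] := trS K.
by have /set1P <- := subsetP SKx y ySK.
Qed.

Lemma incidence_edgeP (G : graph)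
    (e : {set vertex_clique_incidence_graph G}) :
  reflect (exists x : G, exists2 K : {K : {set G} | maximal_clique K},
             x \in val K & e = [set inl x; inr K])
          (e \in edges (vertex_clique_incidence_graph G)).
Proof.
rewrite inE; apply: (iffP existsP) => [[u /existsP[v]]|[x [K xK ->]]].
  case: u v => [x|K] [y|L] //= /andP[xL /eqP->]; first by exists x, L.
  by exists y, K; rewrite // setUC.
by exists (inl x); apply/existsP; exists (inr K); rewrite /= xK eqxx.
Qed.

(** Everything follows from [memK]: among the elements of [S], only [x] lies in [K x]. Indexing by
    the subtype of [S] avoids choosing cliques for vertices outside [S]. *)
Lemma private_cliques_induced_matching (G : graph) (S : {set G})
    (K : {x | x \in S} -> {K : {set G} | maximal_clique K}) :
  (forall x, S :&: val (K x) = [set val x]) ->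
  exists2 M : {set {set vertex_clique_incidence_graph G}},
    induced_matching M & #|M| = #|S|.
Proof.
move=> privK.
have memK (x : {x | x \in S}) y : y \in S -> (y \in val (K x)) = (y == val x).
  by move=> yS; have /setP/(_ y) := privK x; rewrite !inE yS.
(* The trace of [K x] on [S] recovers [x]. *)
have injK : injective K.
  by move=> x y eqK; apply/val_inj/set1_inj; rewrite -!privK eqK.
pose f x : {set vertex_clique_incidence_graph G} :=
  [set inl (val x); inr (K x)].
have inl_f x y : (inl y \in f x) = (y == val x) by rewrite !inE orbF.
have inr_f x L : (inr L \in f x) = (L == K x) by rewrite !inE.
exists [set f x | x in [set: {x | x \in S}]]; last first.
  rewrite card_imset ?cardsT ?card_sig // => x y eqf.
  by apply/val_inj/eqP; rewrite -inl_f -eqf inl_f.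
apply/and3P; split.
- apply/subsetP => _ /imsetP[x _ ->]; apply/incidence_edgeP.
  by exists (val x), (K x); rewrite // memK ?eqxx ?(valP x).
(* A common endpoint of two edges, be it a vertex or a clique, forces their indices to agree; the
   clique case uses [injK]. *)
- apply/trivIsetP => _ _ /imsetP[x _ ->] /imsetP[y _ ->] fxy.
  rewrite -setI_eq0; apply: contraNT fxy => /set0Pn[[z|L] /setIP[]].
    by rewrite !inl_f => /eqP-> /eqP/val_inj->.
  by rewrite !inr_f => /eqP-> /eqP/injK->.
- apply/forall_inP => _ /incidence_edgeP[y [L yL ->]].
  apply/implyP; rewrite subUset !sub1set => /andP[].
  move=> /bigcupP[_ /imsetP[z _ ->]]; rewrite inl_f => /eqP eq_yz.
  move=> /bigcupP[_ /imsetP[x _ ->]]; rewrite inr_f => /eqP eq_LK.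
  (* The covered edge joins some [z] in [S] to some [K x]; privacy of [K x] gives [z = x], so the
     edge is [f x]. *)
  move: yL; rewrite eq_LK eq_yz memK ?(valP z) // => /eqP->.
  exact: imset_f.
Qed.

Theorem corollary5p2 (G : graph) :
  upper_clique_transversal_number G
    <= induced_matching_number (vertex_clique_incidence_graph G).
Proof.
apply/bigmax_leqP => S minS.
(* Finite choice turns the existence of private cliques into a function on [S]. *)
have [K privK] :=
  fin_all_exists (fun x : {x | x \in S} =>
    private_maximal_clique _ _ _ minS (valP x)).
have [M indM <-] := private_cliques_induced_matching _ _ _ privK.
exact: leq_bigmax_cond.
Qed.
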